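(* For all integers $m,k,j\geq 0$ with $j\ge k$, $$\sum_{C\in\mathscr{C}_{m,k,j}}\prod_{i\geq1}t_i^{u_i(C)}\prod_{i\geq1}s_i^{h_i(C)} =\frac{\mathbf{P}_{k}^{(j-k+1)}\big(1!s_1,2!s_2,\ldots\big)}{k!}\cdot\frac{(j-k)!\,\mathbf{B}_{m,j-k}\big(1!t_1,2!t_2,\ldots\big)}{m!}.$$
   Context: The $t_i,s_i$ are commuting indeterminates. A composition of a nonnegative integer $m$ into $j$ parts is an ordered sequence $(\lambda_1,\ldots,\lambda_j)$ of nonnegative integers summing to $m$. $\mathscr{C}_{m,k,j}$ is the set of compositions of $m$ into $j$ parts exactly $k$ of which are zero. For a composition $C$, $u_i(C)$ is the number of parts equal to $i$ ($i\ge1$), and $h_i(C)$ is the number of maximal runs of consecutive zero parts of length exactly $i$. The partial Bell polynomial is $\mathbf{B}_{n,r}(x_1,x_2,\ldots)=\sum \frac{n!}{r_1!\cdots r_n!}\prod_{i=1}^n\left(\frac{x_i}{i!}\right)^{r_i}$, summed over nonnegative integer solutions of $r_1+\cdots+r_n=r$, $r_1+2r_2+\cdots+nr_n=n$ (so $\mathbf{B}_{0,0}=1$, $\mathbf{B}_{n,0}=0$ for $n\ge1$). For a complex number $\lambda$, the potential polynomials $\mathbf{P}_n^{(\lambda)}(f_1,f_2,\ldots)$ are defined by $1+\sum_{n\geq1}\mathbf{P}_n^{(\lambda)}\frac{u^n}{n!}=\left(1+\sum_{n\ge1}f_n\frac{u^n}{n!}\right)^{\lambda}$, with $\mathbf{P}_0^{(\lambda)}=1$.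 *)

(* Defs.v *)
From mathcomp Require Import all_boot all_order all_algebra finmap.
From mathcomp.multinomials Require Export monalg.

Set Implicit Arguments.
Unset Strict Implicit.
Unset Printing Implicit Defensive.

Import GRing.Theory Num.Theory.
Local Open Scope ring_scope.

(* Polynomials over F in the commuting indeterminates t_0, t_1, ... and
   s_0, s_1, ...; the ones of index 0 are never used. *)
Notation polyTS F := {malg F[{cmonom (nat + nat)%type}]}.

Definition tvar (F : numFieldType) (i : nat) : polyTS F := << ucm (inl i) >>.
Definition svar (F : numFieldType) (i : nat) : polyTS F := << ucm (inr i) >>.

Definition parts (m j : nat) (C : j.-tuple 'I_m.+1) : seq nat :=
  [seq nat_of_ord x | x <- C].

(* The parts of a composition of m are at most m, hence their type 'I_m.+1. *)
Definition compositions (m k j : nat) : {set j.-tuple 'I_m.+1} :=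
  [set C : j.-tuple 'I_m.+1 |
     (sumn (parts C) == m) && (count_mem 0%N (parts C) == k)].

Definition u_ (i : nat) (c : seq nat) : nat := count_mem i c.

(* The entries of c at positions a, ..., a + i - 1 form a maximal run of
   zeros. *)
Definition zero_run (c : seq nat) (i a : nat) : bool :=
  [&& (a + i <= size c)%N,
      all (pred1 0%N) (take i (drop a c)),
      (a == 0%N) || (nth 0%N c a.-1 != 0%N) &
      (a + i == size c)%N || (nth 0%N c (a + i) != 0%N)].

Definition h_ (i : nat) (c : seq nat) : nat :=
  count (zero_run c i) (iota 0 (size c)).

(* In bell and potential, the sequence x_1, x_2, ... is given as a function on
   nat whose value at 0 is ignored. *)
Section BellPotential.

Variables (F : numFieldType) (A : comAlgType F).

(* The value of r at i : 'I_n is the exponent r_(i+1); the constraint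
   r_1 + 2 r_2 + ... + n r_n = n forces all the exponents to be at most n. *)
Definition bell (n r : nat) (x : nat -> A) : A :=
  \sum_(e : {ffun 'I_n -> 'I_n.+1} |
          (\sum_(i < n) e i == r)%N && (\sum_(i < n) i.+1 * e i == n)%N)
     (n`!%:R / (\prod_(i < n) (e i)`!)%:R : F) *:
       \prod_(i < n) ((i.+1`!%:R : F)^-1 *: x i.+1) ^+ e i.

(* A formal power series in u is the sequence of its coefficients. *)
Definition fps_one : nat -> A := fun n => (n == 0%N)%:R.

Definition fps_mul (f g : nat -> A) : nat -> A :=
  fun n => \sum_(i < n.+1) f i * g (n - i)%N.

Definition fps_exp (f : nat -> A) (r : nat) : nat -> A :=
  iter r (fps_mul f) fps_one.

Definition gbinom (lam : F) (r : nat) : F :=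
  (\prod_(i < r) (lam - i%:R)) / r`!%:R.

(* (1 + g)^lam = \sum_r gbinom lam r g^r for a series g without constant term;
   since g^r has order at least r, only the terms r <= n contribute to the
   coefficient of u^n. *)
Definition fps_pow1 (g : nat -> A) (lam : F) : nat -> A :=
  fun n => \sum_(r < n.+1) gbinom lam r *: fps_exp g r n.

(* \sum_(n >= 1) f_n u^n / n! *)
Definition egf (f : nat -> A) : nat -> A :=
  fun n => if n == 0%N then 0 else (n`!%:R : F)^-1 *: f n.

Definition potential (n : nat) (lam : F) (f : nat -> A) : A :=
  (n`!%:R : F) *: fps_pow1 (egf f) lam n.

End BellPotential.

(* Main.v *)
(* With S = 1 + \sum_(i >= 1) s_i u^i, T = \sum_(i >= 1) t_i v^i and r = j - k,
   both sides are the coefficient of u^k v^m in S^(r+1) T^r: a composition with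
   r nonzero parts has r + 1 possibly empty runs of zeros around them. On the
   left this follows by reading the composition from left to right and keeping
   track of the length a of the current run of zeros, which turns one factor S
   into \sum_i s_(a+i) u^i (with s_0 = 1); on the right it is the multinomial
   theorem, read off from \prod_i exp(x_i z) = exp((\sum_i x_i) z). *)

Require Import Defs.
From mathcomp Require Import all_boot all_order all_algebra zify ring.

Set Implicit Arguments.
Unset Strict Implicit.
Unset Printing Implicit Defensive.

Import GRing.Theory Num.Theory.
Local Open Scope ring_scope.

(** * The multinomial theorem by exponential generating functions *)

Section Multinomial.

Variables (R : comNzRingType) (inv_fact : nat -> R).
Hypothesis inv_factK : forall n, inv_fact n * n`!%:R = 1.

(** This is [exp(y z) exp(w z) = exp((y + w) z)], iterated. Cutting the series after [z^N] leaves
    the coefficients up to [z^N] of the product intact. *)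
Lemma truncated_exp_prod (N p : nat) (x : 'I_p -> R) (r : nat) : (r <= N)%N ->
  (\prod_(i < p) \poly_(a < N.+1) (inv_fact a * x i ^+ a))`_r =
    inv_fact r * (\sum_(i < p) x i) ^+ r.
Proof.
elim: p x r => [|p IHp] x r le_rN.
  rewrite !big_ord0 coef1 expr0n; case: r le_rN => [|r] _ /=;
    last by rewrite mulr0.
  by rewrite -[LHS](inv_factK 0) mulr1.
rewrite !big_ord_recl coefM exprDn big_distrr /= (reindex_inj rev_ord_inj) /=.
apply: eq_bigr => i _; have le_ir : (i <= r)%N by rewrite -ltnS.
rewrite subSS subKn // coef_poly ltnS (leq_trans (leq_subr _ _) le_rN).
rewrite IHp; last first.
  exact: leq_trans le_ir le_rN.
rewrite -mulr_natr; set y := x _ ^+ _; set z := (\sum_(_ < _) _) ^+ _.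
(* The factor [inv_fact r * r! = 1] is inserted so that [r!] can be split as
   ['C(r, i) * i! * (r - i)!]. *)
have -> : inv_fact (r - i) * y * (inv_fact i * z) =
  inv_fact (r - i) * inv_fact i * (inv_fact r * r`!%:R) * (y * z).
  by rewrite inv_factK; ring.
rewrite -(bin_fact le_ir) !natrM.
transitivity (inv_fact r * (y * z * 'C(r, i)%:R) * (inv_fact i * i`!%:R) *
  (inv_fact (r - i) * (r - i)`!%:R)); first by ring.
by rewrite !inv_factK !mulr1.
Qed.

(** Expanding the product of truncated exponentials by distributivity, [e i] is the power of [z]
    taken from factor [i]; the coefficient of [z^r] keeps the [e] of sum [r]. The bound [N] on
    exponents matches the index type in [bell]. *)
Lemma multinomial_theorem (N p : nat) (x : 'I_p -> R) (r : nat) : (r <= N)%N ->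
  (\sum_(i < p) x i) ^+ r =
    r`!%:R * \sum_(e : {ffun 'I_p -> 'I_N.+1} | (\sum_(i < p) e i == r)%N)
               \prod_(i < p) (inv_fact (e i) * x i ^+ e i).
Proof.
move=> le_rN; transitivity (r`!%:R * (inv_fact r * (\sum_(i < p) x i) ^+ r)).
  by rewrite mulrA [_`!%:R * _]mulrC inv_factK mul1r.
rewrite -(truncated_exp_prod _ le_rN); congr (_ * _).
under eq_bigr => i _ do rewrite poly_def.
rewrite bigA_distr_bigA /= coef_sum [RHS]big_mkcond /=; apply: eq_bigr => e _.
rewrite scaler_prod -expr_sum coefZ coefXn eq_sym.
by case: eqP; rewrite ?mulr1 ?mulr0.
Qed.

End Multinomial.

(** * Potential and Bell polynomials as coefficients of powers of series *)

Section PowerSeries.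

Variables (F : numFieldType) (A : comAlgType F).
Implicit Types (f x : nat -> A) (n r : nat).

Definition with_const (c : A) x : nat -> A :=
  fun n => if n == 0%N then c else x n.

(** Transfers powers of series to the ring of polynomials, where the binomial and multinomial
    theorems apply. *)
Lemma coef_exp_trunc f N r n : (n <= N)%N ->
  ((\poly_(i < N.+1) f i) ^+ r)`_n = fps_exp f r n.
Proof.
elim: r n => [|r IHr] n le_nN; first by rewrite expr0 coef1.
rewrite exprS coefM /= /fps_mul; apply: eq_bigr => i _.
have le_in : (i <= n)%N by rewrite -ltnS.
rewrite coef_poly ltnS (leq_trans le_in le_nN) IHr //.
exact: leq_trans (leq_subr _ _) le_nN.
Qed.

Lemma fps_exp_order x r n : (n < r)%N -> fps_exp (with_const 0 x) r n = 0.
Proof.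
elim: r n => // r IHr n lt_nr; rewrite /= /fps_mul big1 // => i _.
have [->|i0] := eqVneq (val i) 0%N; first by rewrite /with_const mul0r.
by rewrite (IHr (n - i)%N) ?mulr0 //; move: i0 (ltn_ord i) lt_nr => /=; lia.
Qed.

Lemma gbinom_nat n r : gbinom (n%:R : F) r = 'C(n, r)%:R.
Proof.
rewrite /gbinom; apply: (canLR (mulfK _)).
  by rewrite pnatr_eq0 -lt0n fact_gt0.
rewrite -natrM bin_ffact.
elim: r => [|r IHr]; first by rewrite big_ord0 ffactn0.
rewrite big_ord_recr /= IHr ffactnSr natrM.
have [le_rn|lt_nr] := leqP r n; first by rewrite natrB.
by rewrite ffact_small // !mul0r.
Qed.

Lemma fps_pow1_nat x r :
  fps_pow1 (with_const 0 x) (r%:R : F) =1 fps_exp (with_const 1 x) r.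
Proof.
move=> n; rewrite -(@coef_exp_trunc _ n r n) //.
have -> : \poly_(i < n.+1) with_const 1 x i =
    1 + \poly_(i < n.+1) with_const 0 x i.
  apply/polyP=> i; rewrite coefD coef1 !coef_poly /with_const.
  by case: i => [|i] /=; rewrite ?addr0 ?add0r.
pose E i := (\poly_(i < n.+1) with_const 0 x i) ^+ i *+ 'C(r, i).
rewrite exprDn (eq_bigr (fun i : 'I_r.+1 => E i)); last first.
  by move=> i _; rewrite expr1n mul1r.
rewrite coef_sum /fps_pow1 -(big_mkord xpredT (fun i => (E i)`_n)).
rewrite -(big_mkord xpredT (fun i =>
  gbinom (r%:R : F) i *: fps_exp (with_const 0 x) i n)).
have EE i : gbinom (r%:R : F) i *: fps_exp (with_const 0 x) i n = (E i)`_n.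
  by rewrite gbinom_nat scaler_nat coefMn coef_exp_trunc.
under eq_bigr => i _ do rewrite EE.
(* The two sums stop at [n] and at [r]. The excess terms of the longer one vanish: for [i > r] by
   the binomial coefficient, for [i > n] because the [i]-th power has order at least [i]. *)
have [le_rn|lt_nr] := leqP r n.
  rewrite (big_cat_nat (n := r.+1)) //=.
  rewrite [X in _ + X]big_nat_cond [X in _ + X]big1 ?addr0 //.
  by move=> i /andP[/andP[lt_ri _] _]; rewrite /E bin_small // mulr0n coef0.
rewrite [RHS](big_cat_nat (n := n.+1)) //=; last exact: ltnW.
rewrite [X in _ + X]big_nat_cond [X in _ + X]big1 ?addr0 //.
by move=> i /andP[/andP[lt_ni _] _]; rewrite -EE fps_exp_order // scaler0.
Qed.

Lemma egf_factorial x : egf (fun i => (i`!%:R : F) *: x i) =1 with_const 0 x.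
Proof.
move=> n; rewrite /egf /with_const; case: eqP => // _.
by rewrite scalerA mulVf ?scale1r // pnatr_eq0 -lt0n fact_gt0.
Qed.

Lemma eq_fps_exp f g r : f =1 g -> fps_exp f r =1 fps_exp g r.
Proof.
move=> eq_fg; elim: r => // r IHr n.
by apply: eq_bigr => i _; rewrite eq_fg; congr (_ * _); exact: IHr.
Qed.

Lemma potential_factorial x k r :
  (k`!%:R : F)^-1 *: potential k (r%:R : F) (fun i => (i`!%:R : F) *: x i) =
    fps_exp (with_const 1 x) r k.
Proof.
rewrite /potential scalerA mulVf ?scale1r ?pnatr_eq0 -?lt0n ?fact_gt0 //.
rewrite -fps_pow1_nat; apply: eq_bigr => i _; congr (_ *: _).
exact/eq_fps_exp/egf_factorial.
Qed.

Lemma bell_factorial x m r :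
  (m`!%:R : F)^-1 *: ((r`!%:R : F) *: bell m r (fun i => (i`!%:R : F) *: x i)) =
    fps_exp (with_const 0 x) r m.
Proof.
have nat_neq0 n : (n`!%:R : F) != 0 by rewrite pnatr_eq0 -lt0n fact_gt0.
(* For [r > m] both sides are 0: [T^r] has order at least [r], and no [e] qualifies since the sum of
   the [e i] is at most that of the [i.+1 * e i]. *)
have [le_rm|lt_mr] := leqP r m; last first.
  rewrite fps_exp_order // /bell big_pred0 ?scaler0 // => e.
  apply/negbTE/andP => -[/eqP er /eqP em].
  suff: (r <= m)%N by rewrite leqNgt lt_mr.
  by rewrite -er -[X in (_ <= X)%N]em; apply: leq_sum => i _; rewrite leq_pmull.
rewrite -(@coef_exp_trunc _ m) //.
have -> : \poly_(i < m.+1) with_const 0 x i =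
    \sum_(i < m) (x i.+1)%:P * 'X^(i.+1).
  rewrite poly_def big_ord_recl scale0r add0r; apply: eq_bigr => i _.
  by rewrite mul_polyC.
(* The multinomial theorem is applied in [{poly A}] to the monomials of [T]; it yields the first
   constraint of [bell], and the coefficient of ['X^m] then yields the second. *)
pose inv_fact n : {poly A} := ((n`!%:R : F)^-1 *: (1 : A))%:P.
rewrite (@multinomial_theorem _ inv_fact _ m) //; last first.
  move=> n; rewrite /inv_fact -polyC_natr -polyCM -scalerAl mul1r.
  by rewrite -(scaler_nat _ (1 : A)) scalerA mulVf // scale1r.
rewrite -polyC_natr coefCM coef_sum /bell -mulr_natl.
pose c (e : {ffun 'I_m -> 'I_m.+1}) :=
  \prod_(i < m) (((e i)`!%:R : F)^-1 *: x i.+1 ^+ e i).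
have coef_e (e : {ffun 'I_m -> 'I_m.+1}) :
  (\prod_(i < m) (inv_fact (e i) * ((x i.+1)%:P * 'X^(i.+1)) ^+ e i))`_m =
    if (\sum_(i < m) i.+1 * e i == m)%N then c e else 0.
  have -> : \prod_(i < m) (inv_fact (e i) * ((x i.+1)%:P * 'X^(i.+1)) ^+ e i) =
      (c e)%:P * 'X^(\sum_(i < m) i.+1 * e i).
    rewrite expr_sum rmorph_prod -big_split; apply: eq_bigr => i _ /=.
    by rewrite exprMn -exprM mulrA -polyC_exp -polyCM -scalerAl mul1r.
  by rewrite coefCM coefXn eq_sym; case: eqP; rewrite ?mulr1 ?mulr0.
rewrite (eq_bigr _ (fun e _ => coef_e e)) -big_mkcondr /= mulr1.
rewrite !scaler_sumr mulr_sumr; apply: eq_bigr => e _.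
rewrite /c scaler_prod prodfV -natr_prod [RHS]mulr_natl -[RHS]scaler_nat.
rewrite !scalerA.
congr (_ *: _).
  by rewrite [_^-1 * _]mulrC -mulrA mulKf.
by apply: eq_bigr => i _; rewrite scalerA mulVf ?scale1r.
Qed.

End PowerSeries.

(** * Compositions read from left to right, and the sums of their weights *)

Section CompositionSums.

Variables (F : numFieldType) (A : comAlgType F).
Variables (t s : nat -> A).

Definition run_weight (a : nat) : A := with_const 1 s a.

(* a is the length of the run of zeros immediately before c *)
Fixpoint weight_after (a : nat) (c : seq nat) : A :=
  match c with
  | [::] => run_weight a
  | 0%N :: c' => weight_after a.+1 c'
  | x :: c' => run_weight a * t x * weight_after 0 c'
  end.

Lemma count_iotaS (P : pred nat) n :
  count P (iota 0 n.+1) = (P 0%N + count (fun i => P i.+1) (iota 0 n))%N.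
Proof. by rewrite /= -(addn0 1%N) iotaDl count_map. Qed.

Lemma zero_run_succ0 i a b c : (b < a)%N ->
  zero_run (nseq a 0%N ++ c) i b.+1 = false.
Proof.
move=> lt_ba; rewrite /zero_run /= nth_cat size_nseq lt_ba nth_nseq lt_ba.
by rewrite !andbF.
Qed.

Lemma h_nseq0 i a : (0 < i)%N -> h_ i (nseq a 0%N) = (i == a).
Proof.
move=> i_gt0; rewrite /h_ size_nseq; case: a => [|a]; first by case: i i_gt0.
rewrite -[nseq _ _]cats0 count_iotaS.
rewrite (eq_in_count (a2 := pred0)) ?count_pred0 ?addn0; last first.
  move=> b; rewrite mem_iota add0n => /andP[_ lt_ba].
  by apply: zero_run_succ0; rewrite ltnW.
congr nat_of_bool; rewrite cats0 /zero_run eqxx orTb add0n drop0 size_nseq.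
have [lt_ia|lt_ai|->] := ltngtP i a.+1.
- by rewrite nth_nseq lt_ia !andbF.
- by [].
- by rewrite take_oversize ?size_nseq // all_nseq orbT.
Qed.

(** The nonzero entry [x] separates the initial block, which is one maximal run when [a > 0], from
    the runs of [c]. *)
Lemma h_cat_nseq0 i a x c : (0 < i)%N -> x != 0%N ->
  h_ i (nseq a 0%N ++ x :: c) = ((i == a) + h_ i c)%N.
Proof.
move=> i_gt0 x_neq0; rewrite /h_ size_cat size_nseq iotaD count_cat add0n.
congr (_ + _)%N.
  case: a => [|a]; first by case: i i_gt0.
  rewrite count_iotaS.
  rewrite (eq_in_count (a2 := pred0)) ?count_pred0 ?addn0; last first.
    move=> b; rewrite mem_iota add0n => /andP[_ lt_ba].
    by apply: zero_run_succ0; rewrite ltnW.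
  congr nat_of_bool; rewrite /zero_run eqxx orTb add0n drop0.
  rewrite size_cat size_nseq take_cat nth_cat size_nseq.
  have [lt_ia|lt_ai|->] := ltngtP i a.+1.
  - by rewrite nth_nseq lt_ia (ltn_eqF (ltn_addr _ lt_ia)) !andbF.
  - by rewrite -(subnSK lt_ai) /= all_cat /= (negbTE x_neq0) !andbF.
  - by rewrite subnn take0 cats0 all_nseq leq_addr x_neq0 !orbT.
(* No run of positive length starts at position [a], which holds [x]; the later positions are those
   of [c] shifted by [a.+1]. *)
have -> : iota a (size (x :: c)) = a :: iota (a.+1 + 0) (size c).
  by rewrite addn0.
rewrite iotaDl [count _ _]/= count_map.
have -> : zero_run (nseq a 0%N ++ x :: c) i a = false.
  rewrite /zero_run drop_size_cat ?size_nseq //.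
  by case: i i_gt0 => // i _; rewrite /= (negbTE x_neq0) !andbF.
rewrite add0n; apply: eq_count => b /=.
rewrite /zero_run size_cat size_nseq /=.
have nth_shift d : nth 0%N (nseq a 0%N ++ x :: c) (a.+1 + d) = nth 0%N c d.
  by rewrite nth_cat size_nseq ltnNge addSn -addnS leq_addr /= addKn.
have -> : drop (a.+1 + b) (nseq a 0%N ++ x :: c) = drop b c.
  rewrite -[drop b c]/(drop b.+1 (x :: c)) drop_cat size_nseq ltnNge.
  by rewrite addSn -addnS leq_addr /= addKn.
rewrite -(addnA a.+1 b i) nth_shift addnS -addSn leq_add2l eqn_add2l.
(* For [b = 0] the left neighbour is [x], which bounds a run just as the beginning of [c] does. *)
congr [&& _, _, _ & _]; case: b => [|b].
  by rewrite addn0 /= nth_cat size_nseq ltnn subnn /= x_neq0.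
by rewrite addnS /= -addSn nth_shift.
Qed.

Lemma prod_run_weight J a : (a <= J)%N ->
  \prod_(1 <= i < J.+1) s i ^+ (i == a) = run_weight a.
Proof.
move=> le_aJ; rewrite /run_weight /with_const; have [->|a0] := eqVneq a 0%N.
  by rewrite big_nat_cond big1 // => -[|i].
rewrite (bigD1_seq a) ?iota_uniq //= ?mem_index_iota ?ltnS ?lt0n ?a0 //.
by rewrite eqxx expr1 big1 ?mulr1 // => i /negbTE ->.
Qed.

(** The prefix of [a] zeros is the run still open, which makes the induction on [c] go through: a
    zero extends it, a nonzero entry closes it. The bounds [M] and [J] keep all parts and run
    lengths within the two products. *)
Lemma weight_afterE M J a c :
  all (fun x => (x <= M)%N) c -> (a + size c <= J)%N ->
  (\prod_(1 <= i < M.+1) t i ^+ u_ i (nseq a 0%N ++ c)) *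
  (\prod_(1 <= i < J.+1) s i ^+ h_ i (nseq a 0%N ++ c)) = weight_after a c.
Proof.
elim: c a => [|[|x] c IHc] a /=.
- rewrite addn0 cats0 => _ le_aJ; rewrite -(prod_run_weight le_aJ).
  rewrite [X in X * _]big_nat_cond [X in X * _]big1 ?mul1r; last first.
    by move=> [|i] // _; rewrite /u_ count_nseq.
  rewrite big_nat_cond [RHS]big_nat_cond.
  by apply: eq_bigr => i /andP[/andP[i_gt0 _] _]; rewrite h_nseq0.
- rewrite addnS => Mc le_J; rewrite -IHc //.
  by rewrite -cat1s catA -[[:: 0%N]]/(nseq 1 0%N) -nseqD addn1.
move=> /andP[le_xM Mc] le_J; rewrite -[weight_after 0 c]IHc //; last by lia.
rewrite -(@prod_run_weight J a); last by lia.
have -> : \prod_(1 <= i < M.+1) t i ^+ u_ i (nseq a 0%N ++ x.+1 :: c) =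
   t x.+1 * \prod_(1 <= i < M.+1) t i ^+ u_ i c.
  transitivity ((\prod_(1 <= i < M.+1) t i ^+ (i == x.+1)) *
     \prod_(1 <= i < M.+1) t i ^+ u_ i c).
    rewrite -big_split /= big_nat_cond [RHS]big_nat_cond.
    apply: eq_bigr => -[|i] // _; rewrite -exprD /u_ count_cat count_nseq /=.
    by rewrite eq_sym.
  congr (_ * _); rewrite (bigD1_seq x.+1) ?iota_uniq //= ?mem_index_iota //.
  by rewrite eqxx expr1 big1 ?mulr1 // => i /negbTE ->.
have -> : \prod_(1 <= i < J.+1) s i ^+ h_ i (nseq a 0%N ++ x.+1 :: c) =
  (\prod_(1 <= i < J.+1) s i ^+ (i == a)) * \prod_(1 <= i < J.+1) s i ^+ h_ i c.
  rewrite -big_split /= big_nat_cond [RHS]big_nat_cond.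
  apply: eq_bigr => i /andP[/andP[i_gt0 _] _].
  by rewrite h_cat_nseq0 // exprD.
ring.
Qed.

(** The bound [M] on the parts is separate from the sum [m], so that the type of tuple entries stays
    fixed when removing the first part lowers [m]. *)
Definition comp_sum (M m k j : nat) (W : seq nat -> A) : A :=
  \sum_(C : j.-tuple 'I_M.+1 |
      (sumn (parts C) == m) && (count_mem 0%N (parts C) == k)) W (parts C).

Lemma comp_sum0 M m k W :
  comp_sum M m k 0 W = if (m == 0%N) && (k == 0%N) then W [::] else 0.
Proof.
rewrite /comp_sum big_mkcond (big_pred1 [tuple]) /=; last first.
  by move=> C; rewrite [C]tuple0; apply/esym/eqP/val_inj.
by rewrite ![0%N == _]eq_sym.
Qed.

Lemma comp_sumS M m k j W : (m <= M)%N ->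
  comp_sum M m k j.+1 W =
    (if k is k'.+1 then comp_sum M m k' j (fun c => W (0%N :: c)) else 0) +
    \sum_(i < m) comp_sum M (m - i.+1) k j (fun c => W (i.+1 :: c)).
Proof.
move=> le_mM; rewrite /comp_sum.
rewrite (reindex (fun p : 'I_M.+1 * j.-tuple 'I_M.+1 =>
  [tuple of p.1 :: p.2])) /=; last first.
  exists (fun C : j.+1.-tuple _ => (thead C, [tuple of behead C])).
    move=> [x C] _ /=.
    by rewrite theadE; congr (_, _); apply: val_inj.
  by move=> C _ /=; rewrite -tuple_eta.
pose P (x : 'I_M.+1) (C : j.-tuple 'I_M.+1) := (x + sumn (parts C) == m)%N &&
  ((x == 0%N :> nat) + count_mem 0%N (parts C) == k)%N.
rewrite (eq_bigl (fun p : 'I_M.+1 * j.-tuple 'I_M.+1 => true && P p.1 p.2)) //.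
rewrite -(pair_big_dep xpredT P (fun x C => W (val x :: parts C))) /=.
rewrite {}/P big_ord_recl /=; congr (_ + _).
  case: k => [|k]; first by rewrite big1 // => C; rewrite andbF.
  by apply: eq_bigl => C; rewrite add0n add1n eqSS.
pose G i := \sum_(C : j.-tuple 'I_M.+1 |
   (i.+1 + sumn (parts C) == m)%N && (count_mem 0%N (parts C) == k)%N)
   W (i.+1 :: parts C).
rewrite (eq_bigr (fun i : 'I_M => G i)) //.
rewrite (bigID (fun i : 'I_M => (i < m)%N)) /= -(big_ord_widen M G) //.
(* A first part greater than [m] leaves no composition. *)
rewrite [X in _ + X]big1 ?addr0; last first.
  move=> i; rewrite -leqNgt => le_mi; rewrite /G big_pred0 // => C.
  by apply/negbTE/negP => /andP[/eqP e _]; lia.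
apply: eq_bigr => i _; apply: eq_bigl => C; congr (_ && _).
have := ltn_ord i; lia.
Qed.

Lemma comp_sum_too_many_zeros M m k j W : (j < k)%N -> comp_sum M m k j W = 0.
Proof.
move=> lt_jk; rewrite /comp_sum big_pred0 // => C; apply/negbTE/nandP; right.
apply: contraTneq lt_jk => <-; rewrite -leqNgt.
by rewrite (leq_trans (count_size _ _)) // size_map size_tuple.
Qed.

(** With [r = j - k], this is the coefficient of [u^k v^m] in [(\sum_i s_(a+i) u^i) S^r T^r]. By
    induction on [j], a nonzero first part closes the open run and gives the term [i = 0]; a zero
    first part replaces [a] by [a.+1] and gives the terms [i >= 1]. *)
Lemma comp_sum_weight M m k j a : (m <= M)%N -> (k <= j)%N ->
  comp_sum M m k j (weight_after a) =
    (\sum_(i < k.+1) run_weight (a + i) * fps_exp run_weight (j - k) (k - i)) *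
    fps_exp (with_const 0 t) (j - k) m.
Proof.
elim: j m k a => [|j IHj] m k a le_mM le_kj.
  have /eqP k0 : k == 0%N by rewrite -leqn0.
  rewrite k0 comp_sum0 big_ord_recl big_ord0 addr0 addn0 /=.
  rewrite /fps_one mulr1 andbT.
  by case: eqP; rewrite ?mulr1 ?mulr0.
rewrite comp_sumS //.
have nonzero_first : \sum_(i < m) comp_sum M (m - i.+1) k j
      (fun c => weight_after a (i.+1 :: c)) =
    run_weight a * fps_exp run_weight (j.+1 - k) k *
    fps_exp (with_const 0 t) (j.+1 - k) m.
  (* If [k = j.+1], every part is zero and both sides vanish. Otherwise the induction hypothesis at
     [a = 0] supplies one more factor [S], and the sum over the first part one more factor [T]. *)
  move: le_kj; rewrite leq_eqVlt => /orP[/eqP -> | ]; last first.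
    rewrite ltnS => le_kj; rewrite (subSn le_kj).
    rewrite [fps_exp (with_const 0 t) _ _]/= /fps_mul big_ord_recl.
    rewrite {1}/with_const mul0r add0r mulr_sumr; apply: eq_bigr => i _.
    transitivity (run_weight a * t i.+1 *
      comp_sum M (m - i.+1) k j (weight_after 0)).
      by rewrite [RHS]mulr_sumr.
    rewrite IHj //; last by rewrite (leq_trans (leq_subr _ _)).
    rewrite /with_const /=; under eq_bigr do rewrite add0n.
    rewrite -/(fps_mul _ _ _); ring.
  rewrite subnn /= /fps_one mulr0 mul0r big1 // => i _.
  exact: comp_sum_too_many_zeros.
rewrite nonzero_first big_ord_recl addn0 subn0 mulrDl addrC; congr (_ + _).
case: k le_kj {nonzero_first} => [|k] le_kj; first by rewrite big_ord0 mul0r.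
rewrite IHj // subSS; congr (_ * _).
by apply: eq_bigr => i _; rewrite addSnnS.
Qed.

End CompositionSums.

(* The products over i >= 1 are cut at m and at j: a part of C is at most m and
   a run of zeros in C has length at most j, so all further exponents vanish. *)
Theorem theorem3p2 (F : numFieldType) (m k j : nat) (le_kj : (k <= j)%N) :
  \sum_(C in compositions m k j)
     (\prod_(1 <= i < m.+1) tvar F i ^+ u_ i (parts C)) *
     (\prod_(1 <= i < j.+1) svar F i ^+ h_ i (parts C))
  = ((k`!%:R : F)^-1 *:
       potential k ((j - k + 1)%N%:R : F) (fun i => (i`!%:R : F) *: svar F i)) *
    ((m`!%:R : F)^-1 *:
       (((j - k)`!%:R : F) *:
          bell m (j - k) (fun i => (i`!%:R : F) *: tvar F i))).
Proof.
rewrite potential_factorial bell_factorial addn1.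
transitivity (comp_sum m m k j (weight_after (tvar F) (svar F) 0)).
  apply: eq_big => [C|C _]; first by rewrite inE.
  rewrite -(weight_afterE _ _ (M := m) (J := j)) //.
    by apply/allP => _ /mapP[x _ ->]; rewrite -ltnS.
  by rewrite size_map size_tuple.
(* At [a = 0] the sum over [i] is by definition the Cauchy product of [S] and [S^(j-k)], hence the
   coefficient in [S^(j-k+1)]. *)
by rewrite comp_sum_weight.
Qed.
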